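(* Let $W$ be a finite-dimensional complex vector space, let $n\ge 1$, and let $\mathbf{s}=(s_1,\dots,s_q)=((q_1)^{t_1},\dots,(q_f)^{t_f})$ with $s_1\ge\cdots\ge s_q\ge 0$ and $|\mathbf{s}|\le n$. For all $\delta>1$ there is a $GL(W)$-module map $$\mathcal{F}_{\mathbf{s}}^{\delta}: S^\delta(S^nW)\to S^{t_1}(S^{\delta q_1}W)\otimes\cdots\otimes S^{t_f}(S^{\delta q_f}W)\otimes S^\delta(S^{n-|\mathbf{s}|}W),$$ namely the explicit map described in the context, whose kernel is $I_\delta(F_{\mathbf{s}}(S^nW^* ))$.
   Context: Notation: $|\mathbf{s}|=s_1+\cdots+s_q$, and $\mathbf{s}=((q_1)^{t_1},\dots,(q_f)^{t_f})$ means that $q_1>\cdots>q_f$ are the distinct values of the $s_j$, with $q_i$ occurring $t_i$ times (so $s_1=\cdots=s_{t_1}=q_1$, etc.). Define $$F_{\mathbf{s}}(S^nW^* ):=\{P\in S^nW^*\mid P=\ell_1^{s_1}\cdots\ell_q^{s_q}h,\ \ell_j\in W^*,\ h\in S^{n-|\mathbf{s}|}W^*\}.$$ $S^\delta(S^nW)$ is regarded as the space of homogeneous polynomials of degree $\delta$ on $S^nW^*$, and $I_\delta(X)\subset S^\delta(S^nW)$ denotes those vanishing on $X$. The map $\mathcal{F}_{\mathbf{s}}^\delta$: include $S^\delta(S^nW)\subset W^{\otimes \delta n}$ and label the tensor factors as $(W_{1,1}\otimes\cdots\otimes W_{1,n})\otimes\cdots\otimes(W_{\delta,1}\otimes\cdots\otimes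 W_{\delta,n})$, all $W_{i,j}$ being copies of $W$. Extract the first $s_1$ factors of each of the $\delta$ groups and collect them at the beginning, then factors $s_1+1,\dots,s_1+s_2$ of each group, and so on through $s_q$, followed by the remaining $n-|\mathbf{s}|$ factors of each group, i.e. regroup as $$(W_{1,1}\otimes\cdots\otimes W_{1,s_1}\otimes\cdots\otimes W_{\delta,1}\otimes\cdots\otimes W_{\delta,s_1})\otimes(W_{1,s_1+1}\otimes\cdots\otimes W_{1,s_1+s_2}\otimes\cdots\otimes W_{\delta,s_1+1}\otimes\cdots\otimes W_{\delta,s_1+s_2})\otimes\cdots\otimes(W_{1,|\mathbf{s}|+1}\otimes\cdots\otimes W_{1,n}\otimes\cdots\otimes W_{\delta,|\mathbf{s}|+1}\otimes\cdots\otimes W_{\delta,n}).$$ Symmetrize each of the groups of $\delta s_j$ factors ($j=1,\dots,q$), and each of the $\delta$ groups of $n-|\mathbf{s}|$ factors, to obtain an element of $S^{\delta s_1}W\otimes\cdots\otimes S^{\delta s_q}W\otimes(S^{n-|\mathbf{s}|}W)^{\otimes\delta}$; symmetrize the ordering of the $\delta$ groups of $n-|\mathbf{s}|$ factors to obtain an element of $S^{\delta s_1}W\otimes\cdots\otimes S^{\delta s_q}W\otimes S^\delta(S^{n-|\mathbf{s}|}W)$; finally, for each set of equal $s_j$'s, symmetrize the corresponding groups, to obtain an element of $S^{t_1}(S^{\delta q_1}W)\otimes\cdots\otimes S^{t_f}(S^{\delta q_f}W)\otimes S^\delta(S^{n-|\mathbf{s}|}W)$. *)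

(* Defs.v *)
From HB Require Import structures.
From mathcomp Require Import all_boot all_order all_algebra all_fingroup.
From mathcomp Require Import reals.
From mathcomp Require Export complex.

Set Implicit Arguments.
Unset Strict Implicit.
Unset Printing Implicit Defensive.

Import GRing.Theory.

Local Open Scope ring_scope.

Section Tensors.
Variable K : fieldType.
Implicit Types (V W : vectType K) (I J : finType).

Definition bvec V (i : 'I_(\dim {:V})) : V := (vbasis {:V})`_i.
Definition bcoord V (i : 'I_(\dim {:V})) (v : V) : K := coord (vbasis {:V}) i v.

(* The tensor power of V whose factors are labelled by I: A k is the
   coefficient of A on the tensor product over x : I of the bvec (k x). *)
Definition tensor V I : vectType K := {ffun {ffun I -> 'I_(\dim {:V})} -> K^o}.
Arguments tensor V I%_type.

Definition pure V I (w : I -> V) : tensor V I :=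
  [ffun k : {ffun I -> 'I_(\dim {:V})} => \prod_x bcoord (k x) (w x)].

Definition tensor_ext V I (U : vectType K)
    (g : {ffun I -> 'I_(\dim {:V})} -> U) : 'Hom(tensor V I, U) :=
  linfun (fun A : tensor V I => \sum_k (A k : K) *: g k).

(* Relabelling of the factors: factor (phi y) of the source becomes factor y
   of the target (see relabel_pure). *)
Definition relabel V I J (phi : J -> I) : 'Hom(tensor V I, tensor V J) :=
  tensor_ext (fun k => pure (fun y => bvec (k (phi y)))).

(* The I-th tensor power of a linear map (see tensor_map_pure). *)
Definition tensor_map V W I (g : 'Hom(V, W)) : 'Hom(tensor V I, tensor W I) :=
  tensor_ext (fun k => pure (fun x => g (bvec (k x)))).

Definition symmetrize V I (G : {set {perm I}}) : 'End(tensor V I) :=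
  #|G|%:R^-1 *: \sum_(sigma in G) relabel V sigma.

Definition invariants V I (G : {set {perm I}}) : {vspace tensor V I} :=
  (\bigcap_(sigma in G) fixedSpace (relabel V sigma))%VS.

(* Permutations preserving every fibre of b. *)
Definition fibre_perms I (B : eqType) (b : I -> B) : {set {perm I}} :=
  [set sigma : {perm I} | [forall x, b (sigma x) == b x]].

(* S^m V, as the symmetric tensors. *)
Definition Sym V m : {vspace tensor V 'I_m} := invariants V [set: 'S_m].

(* The slot (i, p) is the p-th factor of the i-th group. *)
Definition group_perms d m : {set {perm 'I_d * 'I_m}} :=
  [set sigma : {perm 'I_d * 'I_m} |
    [exists tau : 'S_d, forall x, sigma x == (tau x.1, x.2)]].

(* S^d (S^m V) inside the (d m)-th tensor power of V. *)
Definition SymSym_perms d m : {set {perm 'I_d * 'I_m}} :=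
  fibre_perms fst :|: group_perms d m.
Definition SymSym V d m : {vspace tensor V ('I_d * 'I_m)} :=
  invariants V (SymSym_perms d m).

Definition dual W : vectType K := 'Hom(W, K^o).

(* The canonical bilinear pairing of a tensor power of W with the same tensor
   power of its dual (see pairing_pure). *)
Definition pairing W I (A : tensor W I) (B : tensor (dual W) I) : K :=
  \sum_j \sum_k (A j * B k : K) * \prod_x (bvec (k x) : 'Hom(W, K^o)) (bvec (j x)).

(* The polynomial function on W defined by P in S^m W^*. *)
Definition poly_at W m (P : tensor (dual W) 'I_m) (w : W) : K :=
  pairing (pure (fun=> w)) P.

Definition tensor_pow V m d (P : tensor V 'I_m) : tensor V ('I_d * 'I_m) :=
  [ffun k : {ffun 'I_d * 'I_m -> 'I_(\dim {:V})} =>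
     \prod_i (P [ffun p => k (i, p)] : K)].

(* The value at P in S^m W^* of A in S^d (S^m W), seen as a homogeneous
   polynomial of degree d on S^m W^*. *)
Definition form_at W d m (A : tensor W ('I_d * 'I_m)) (P : tensor (dual W) 'I_m)
  : K := pairing A (tensor_pow d P).

(* Membership in I_d(X), for A in S^d (S^m W) and X contained in S^m W^*. *)
Definition in_ideal W d m (X : tensor (dual W) 'I_m -> Prop)
    (A : tensor W ('I_d * 'I_m)) : Prop :=
  forall P, X P -> form_at A P = 0.

(* F_s(S^n W^* ); the equality P = l_1^{s_1} ... l_q^{s_q} h is one between
   polynomials, expressed on their values, K being infinite in the sequel. *)
Definition Fs W n (s : seq nat) (P : tensor (dual W) 'I_n) : Prop :=
  P \in Sym (dual W) n /\
  exists (l : 'I_(size s) -> 'Hom(W, K^o)) (h : tensor (dual W) 'I_(n - sumn s)),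
    h \in Sym (dual W) (n - sumn s) /\
    forall w : W,
      poly_at P w = (\prod_(j < size s) (l j w : K) ^+ nth 0%N s j) * poly_at h w.

Lemma sum_bcoord V (v : V) : v = \sum_i bcoord i v *: bvec i.
Proof. by rewrite {1}(coord_vbasis (memvf v)). Qed.

Lemma bcoord_bvec V (i j : 'I_(\dim {:V})) : bcoord i (bvec j) = (i == j)%:R.
Proof.
by rewrite /bcoord /bvec coord_free 1?eq_sym //; apply: basis_free (vbasisP _).
Qed.

Lemma tensor_extE V I (U : vectType K) (g : {ffun I -> 'I_(\dim {:V})} -> U) A :
  tensor_ext g A = \sum_k (A k : K) *: g k.
Proof.
pose f (A : tensor V I) := \sum_k (A k : K) *: g k.
have lf : linear f.
  move=> a u v; rewrite /f scaler_sumr -big_split /=; apply: eq_bigr => k _.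
  by rewrite !ffunE scalerDl scalerA.
pose fl := GRing.isLinear.Build _ _ _ _ f lf.
pose F : {linear tensor V I -> U} := HB.pack f fl.
by rewrite /tensor_ext -[RHS]/(F A) -(lfunE F).
Qed.

Lemma tensor_sum_pure V I (A : tensor V I) :
  A = \sum_k (A k : K) *: pure (fun x => bvec (k x)).
Proof.
apply/ffunP=> k0; rewrite sum_ffunE (bigD1 k0) //= big1 ?addr0 => [|k kk0].
  rewrite !ffunE big1 => [|x _]; first by rewrite /GRing.scale /= mulr1.
  by rewrite bcoord_bvec eqxx.
rewrite !ffunE; have /existsP[x xP] : [exists x, k0 x != k x].
  rewrite -negb_forall; apply: contra kk0 => /forallP e.
  by apply/eqP/ffunP=> x; rewrite (eqP (e x)).
by rewrite (bigD1 x) //= bcoord_bvec (negPf xP) mul0r /GRing.scale /= mulr0.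
Qed.

Lemma prod_sum_ord V I (F : I -> 'I_(\dim {:V}) -> K) :
  \prod_x \sum_i F x i = \sum_(k : {ffun I -> 'I_(\dim {:V})}) \prod_x F x (k x).
Proof. exact: bigA_distr_bigA. Qed.

Lemma tensor_map_pure V W I (g : 'Hom(V, W)) (w : I -> V) :
  tensor_map I g (pure w) = pure (fun x => g (w x)).
Proof.
rewrite /tensor_map tensor_extE; apply/ffunP=> k; rewrite sum_ffunE.
transitivity (\prod_x \sum_i (bcoord i (w x) * bcoord (k x) (g (bvec i)))).
  rewrite prod_sum_ord; apply: eq_bigr => j _.
  by rewrite !ffunE /GRing.scale /= -big_split.
rewrite ffunE; apply: eq_bigr => x _; rewrite {2}[w x]sum_bcoord.
by rewrite /bcoord !linear_sum /=; apply: eq_bigr => i _; rewrite !linearZ.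
Qed.

Lemma relabel_pure V I J (phi : J -> I) (w : I -> V) : bijective phi ->
  relabel V phi (pure w) = pure (fun y => w (phi y)).
Proof.
move=> bphi; rewrite /relabel tensor_extE; apply/ffunP=> k; rewrite sum_ffunE.
transitivity (\prod_y \sum_i
    (bcoord i (w (phi y)) * bcoord (k y) (bvec i))); last first.
  rewrite ffunE; apply: eq_bigr => y _; rewrite {2}[w (phi y)]sum_bcoord.
  by rewrite {3}/bcoord linear_sum /=; apply: eq_bigr => i _; rewrite linearZ.
have [psi phiK psiK] := bphi.
rewrite prod_sum_ord (reindex (fun k : {ffun J -> 'I_(\dim {:V})} =>
    [ffun x => k (psi x)] : {ffun I -> 'I_(\dim {:V})})) /=; last first.
  exists (fun k : {ffun I -> 'I_(\dim {:V})} => [ffun y => k (phi y)]) => h _;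
    by apply/ffunP=> x; rewrite !ffunE ?phiK ?psiK.
apply: eq_bigr => h _; rewrite !ffunE /GRing.scale /= big_split /=.
rewrite (reindex phi) /=; last exact: onW_bij.
by congr (_ * _); apply: eq_bigr => y _; rewrite ffunE phiK.
Qed.

Lemma pairing_pure W I (w : I -> W) (l : I -> 'Hom(W, K^o)) :
  pairing (pure w) (pure (V := dual W) l) = \prod_x (l x (w x) : K).
Proof.
transitivity (\prod_x \sum_i (bcoord i (w x) * (l x (bvec i) : K))); last first.
  apply: eq_bigr => x _; rewrite {2}[w x]sum_bcoord linear_sum /=.
  by apply: eq_bigr => i _; rewrite linearZ.
rewrite prod_sum_ord; apply: eq_bigr => j _; rewrite big_split /=.
under eq_bigr do rewrite !ffunE -mulrA -big_split /=.
rewrite -mulr_sumr; congr (_ * _); rewrite -(prod_sum_ord (V := dual W)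
  (fun x i => bcoord (i : 'I_(\dim {:dual W})) (l x) * (bvec i : 'Hom(W, K^o)) (bvec (j x)))).
apply: eq_bigr => x _; rewrite {2}[l x](@sum_bcoord (dual W)) sum_lfunE.
by apply: eq_bigr => i _; rewrite lfunE.
Qed.

Lemma tensor_pow_pure V m d (w : 'I_m -> V) :
  tensor_pow d (pure w) = pure (fun x => w x.2).
Proof.
apply/ffunP=> k; rewrite !ffunE; under eq_bigr do rewrite ffunE.
rewrite pair_big /=; apply: eq_bigr => -[i p] _ /=; by rewrite ffunE.
Qed.

Lemma relabel_tensor_map V W I J (phi : J -> I) (g : 'Hom(V, W)) A :
  bijective phi ->
  relabel W phi (tensor_map I g A) = tensor_map J g (relabel V phi A).
Proof.
move=> bphi; rewrite [A]tensor_sum_pure !linear_sum /=; apply: eq_bigr => k _.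
by rewrite !linearZ /= tensor_map_pure !relabel_pure // tensor_map_pure.
Qed.

Lemma invariantsP V I (G : {set {perm I}}) A :
  reflect (forall sigma, sigma \in G -> relabel V sigma A = A)
          (A \in invariants V G).
Proof.
rewrite memvE; apply: (iffP subv_bigcapP) => h sigma sG.
  by apply/fixedSpaceP; rewrite memvE h.
by rewrite -memvE; apply/fixedSpaceP/h.
Qed.

Lemma invariants_stable V I (G : {set {perm I}}) (g : 'End(V)) A :
  A \in invariants V G -> tensor_map I g A \in invariants V G.
Proof.
move/invariantsP=> h; apply/invariantsP=> sigma sG.
rewrite relabel_tensor_map ?h //; exact/injF_bij/perm_inj.
Qed.

(* The action of GL(V), and in fact of End(V), on a space of invariants. *)
Definition inv_act V I (G : {set {perm I}}) (g : 'End(V))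
    (A : subvs_of (invariants V G)) : subvs_of (invariants V G) :=
  Subvs (invariants_stable g (subvsP A)).

End Tensors.

Arguments tensor {K} V I%_type.

Section Slots.
Variables (d n : nat) (s : seq nat).

(* For s nonincreasing, s = ((q_1)^{t_1}, ..., (q_f)^{t_f}) where
   f = size (undup s), q_{a+1} = dval a and t_{a+1} = dmult a. *)
Definition dval (a : 'I_(size (undup s))) : nat := nth 0%N (undup s) a.
Definition dmult (a : 'I_(size (undup s))) : nat := count_mem (dval a) s.

(* inl (a, (c, (i, b))) is the b-th of the factors taken from the i-th group
   for the c-th part of s equal to dval a; inr (i, b) is the b-th of the
   remaining factors of the i-th group. *)
Definition slot : finType :=
  ({a : 'I_(size (undup s)) & 'I_(dmult a) * ('I_d * 'I_(dval a))}
   + 'I_d * 'I_(n - sumn s))%type.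

Definition slot_group (x : slot) : 'I_d :=
  match x with
  | inl (existT a (c, (i, b))) => i
  | inr (i, b) => i
  end.

(* Equal parts of s being contiguous, the c-th part equal to dval a has index
   index (dval a) s + c in s. *)
Definition slot_pos (x : slot) : nat :=
  match x with
  | inl (existT a (c, (i, b))) => sumn (take (index (dval a) s + c) s) + b
  | inr (i, b) => sumn s + b
  end.

(* slot_pos x < n when s is nonincreasing of sum at most n, and then slot_source is
   bijective (slot_pos_lt, slot_source_bij): the default value given to insubd is irrelevant. *)
Definition slot_source (hn : (0 < n)%N) (x : slot) : 'I_d * 'I_n :=
  (slot_group x, insubd (Ordinal hn) (slot_pos x)).

(* Labels the q groups of d s_j factors and the d groups of remaining ones. *)
Definition slot_block (x : slot) :
    ({a : 'I_(size (undup s)) & 'I_(dmult a)} + 'I_d)%type :=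
  match x with
  | inl (existT a (c, (i, b))) => inl (existT _ a c)
  | inr (i, b) => inr i
  end.

Definition block_perms : {set {perm slot}} := fibre_perms slot_block.

Definition rest_move (tau : 'S_d) (x : slot) : slot :=
  match x with
  | inl y => inl y
  | inr (i, b) => inr (tau i, b)
  end.
Definition rest_perms : {set {perm slot}} :=
  [set sigma : {perm slot} |
    [exists tau : 'S_d, forall x, sigma x == rest_move tau x]].

Definition equal_move (pi : {dffun forall a, 'S_(dmult a)}) (x : slot) : slot :=
  match x with
  | inl (existT a (c, y)) => inl (existT _ a (pi a c, y))
  | inr y => inr y
  end.
Definition equal_perms : {set {perm slot}} :=
  [set sigma : {perm slot} |
    [exists pi : {dffun forall a, 'S_(dmult a)},
      forall x, sigma x == equal_move pi x]].

Definition target_perms : {set {perm slot}} :=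
  block_perms :|: rest_perms :|: equal_perms.

End Slots.

Lemma nth_part (v c : nat) (s : seq nat) : sorted geq s ->
  (c < count_mem v s)%N ->
  (index v s + c < size s)%N /\ nth 0%N s (index v s + c) = v.
Proof.
elim: s c => [|x s IH] c //= xs.
have ss : sorted geq s := path_sorted xs.
have [xv | xv] := eqVneq x v; last by rewrite add0n => /(IH _ ss)[].
rewrite {}xv {x} in xs *.
case: c => [|c] // cs; rewrite add1n ltnS in cs.
have [] := IH c ss cs; suff -> : index v s = 0%N by [].
have vs : v \in s by rewrite -has_pred1 has_count (leq_ltn_trans _ cs).
case: s xs {IH ss cs} vs => [|y s] //= /andP[yv ys].
rewrite inE eq_sym; case: eqVneq => //= y_v vs.
have geqT : transitive geq by move=> z1 z2 z3 z12 z23; apply: leq_trans z23 z12.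
have /= vy := allP (order_path_min geqT ys) _ vs.
by case/eqP: y_v; apply/eqP; rewrite eqn_leq yv.
Qed.

Section SlotsTheory.
Variables (d n : nat) (s : seq nat).

Lemma sumn_take_nth j : (j < size s)%N ->
  sumn (take j.+1 s) = (sumn (take j s) + nth 0%N s j)%N.
Proof. by move=> js; rewrite (take_nth 0%N js) sumn_rcons. Qed.

Lemma sumn_take_le j j' : (j <= j')%N -> (sumn (take j s) <= sumn (take j' s))%N.
Proof.
by move=> jj; rewrite -(subnKC jj) takeD sumn_cat leq_addr.
Qed.

Lemma sumn_take_le_sumn j : (sumn (take j s) <= sumn s)%N.
Proof. by rewrite -{2}(cat_take_drop j s) sumn_cat leq_addr. Qed.

Lemma slot_pos_lt (x : slot d n s) :
  sorted geq s -> (sumn s <= n)%N -> (slot_pos x < n)%N.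
Proof.
move=> ss sn; case: x => [[a [c [i b]]]|[i b]] /=; last first.
  by rewrite -ltn_subRL ltn_ord.
have [js jv] := nth_part ss (ltn_ord c).
rewrite (leq_trans _ sn) // (leq_trans _ (sumn_take_le_sumn (index (dval a) s + c).+1)) //.
by rewrite sumn_take_nth // jv ltn_add2l.
Qed.

Lemma slot_source_inj (hn : (0 < n)%N) : sorted geq s -> (sumn s <= n)%N ->
  injective (slot_source hn : slot d n s -> 'I_d * 'I_n).
Proof.
move=> ss sn x y [exy]; move/(congr1 val); rewrite !val_insubd !slot_pos_lt //.
have main_rest (z : {a & 'I_(dmult (s:=s) a) * ('I_d * 'I_(dval a))}%type) (t : 'I_d * 'I_(n - sumn s)) :
    slot_pos (inl z : slot d n s) <> slot_pos (inr t : slot d n s).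
  case: z t => [a [c [i b]]] [i' b'] /= e.
  have [js jv] := nth_part ss (ltn_ord c).
  have := sumn_take_le_sumn (index (dval a) s + c).+1.
  rewrite sumn_take_nth // jv leqNgt; case/negP.
  by rewrite (leq_ltn_trans (leq_addr b' _)) // -e ltn_add2l.
case: x y exy => [x|[i b]] [y|[i' b']] /=; first last.
- by move=> -> /addnI/val_inj->.
- by move=> _ /esym e; case: (main_rest y (i, b)).
- by move=> _ e; case: (main_rest x (i', b')).
case: x y => [a [c [i b]]] [a' [c' [i' b']]] /= eii; rewrite -{}eii {i'} => e.
have [js jv] := nth_part ss (ltn_ord c).
have [js' jv'] := nth_part ss (ltn_ord c').
set j := (index (dval a) s + c)%N in js jv e.
set j' := (index (dval a') s + c')%N in js' jv' e.
have jj : j = j'.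
  have lt : forall (j j' b b' : nat), (j < size s)%N -> (b < nth 0%N s j)%N ->
      (j < j')%N -> (sumn (take j s) + b < sumn (take j' s) + b')%N.
    move=> k k' u u' ks us kk; rewrite (leq_trans _ (leq_addr _ _)) //.
    by rewrite (leq_trans _ (sumn_take_le kk)) // sumn_take_nth // ltn_add2l.
  have [jj|jj|//] := ltngtP j j'.
    by have := lt _ _ b b' js _ jj; rewrite jv e ltnn => /(_ (ltn_ord b)).
  by have := lt _ _ b' b js' _ jj; rewrite jv' e ltnn => /(_ (ltn_ord b')).
have aa : a = a'.
  apply/val_inj/eqP; rewrite -(nth_uniq 0%N (ltn_ord a) (ltn_ord a')) ?undup_uniq //.
  by rewrite -/(dval a) -/(dval a') -jv -jv' jj.
move: c' b' @j' js' jv' e jj; rewrite -{a'}aa => c' b' /= js' jv' e jj.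
have cc : c = c' by apply/val_inj/(@addnI (index (dval a) s)).
move: e; rewrite -/j jj => /addnI/val_inj ->.
by rewrite cc.
Qed.

Lemma slot_source_bij (hn : (0 < n)%N) : sorted geq s -> (sumn s <= n)%N ->
  bijective (slot_source hn : slot d n s -> 'I_d * 'I_n).
Proof.
move=> ss sn; apply: inj_card_bij; first exact: slot_source_inj.
rewrite card_sum card_tagged !card_prod !card_ord sumnE big_map big_enum /=.
under eq_bigr do rewrite !card_prod !card_ord mulnCA.
rewrite -big_distrr /= -mulnDr leq_mul2l -leq_subLR.
suff -> : (\sum_(a < size (undup s)) dmult a * dval a = sumn s)%N by rewrite leqnn orbT.
rewrite sumnE -(perm_big _ (perm_count_undup s)) /=.
rewrite big_flatten big_map (big_nth 0%N) big_mkord; apply: eq_bigr => a _.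
by rewrite big_nseq iter_addn_0 mulnC.
Qed.

End SlotsTheory.

Section Map.
Variable K : fieldType.
Variable W : vectType K.

(* S^{t_1}(S^{d q_1} W) (x) ... (x) S^{t_f}(S^{d q_f} W) (x) S^d (S^{n-|s|} W). *)
Definition target d n s : {vspace tensor W (slot d n s)} :=
  invariants W (target_perms d n s).

Definition calF d n s (hn : (0 < n)%N) :
    'Hom(tensor W ('I_d * 'I_n), tensor W (slot d n s)) :=
  (symmetrize W (equal_perms d n s) \o
   symmetrize W (rest_perms d n s) \o
   symmetrize W (block_perms d n s) \o
   relabel W (slot_source (s := s) hn))%VF.

End Map.

(* Main.v *)
(* Pairing A with the d-th power of P = l_1^{s_1} ... l_q^{s_q} h amounts to
   pairing the regrouped tensor with M(l, h), the tensor product of the powers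
   l_j^{d s_j} and of h^{(x) d}.  Up to symmetries under which M(l, h) is
   invariant (blocks and order of the h's) or under which the regrouped tensor
   already is (exchange of equal parts), the latter is F(A), so that
   A(P) = <F(A), M(l, h)>; hence F(A) = 0 implies that A vanishes on F_s.
   Conversely, if all the <F(A), M(l, h)> vanish, polarizing first in h and then
   in each of the blocks shows that the invariant tensor F(A) pairs to 0 with
   every tensor, as it is invariant under the corresponding permutations. *)

From HB Require Import structures.
From mathcomp Require Import all_boot all_order all_algebra all_fingroup.
From mathcomp Require Import boolp reals complex.
Require Import Defs.

Set Implicit Arguments.
Unset Strict Implicit.
Unset Printing Implicit Defensive.

Import GRing.Theory Num.Theory.

Local Open Scope ring_scope.

(** * Relabelling of tensor factors and symmetrization *)

Section Relabelling.
Variable K : fieldType.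
Implicit Types (V W : vectType K) (I J L : finType).

Lemma relabelE V I J (phi : J -> I) (psi : I -> J) :
  cancel phi psi -> cancel psi phi ->
  forall (A : tensor V I) k, relabel V phi A k = A [ffun x => k (psi x)].
Proof.
move=> phiK psiK A k; have bphi : bijective phi by exists psi.
rewrite [in LHS](tensor_sum_pure A) linear_sum /= sum_ffunE.
rewrite [in RHS](tensor_sum_pure A) sum_ffunE; apply: eq_bigr => j _.
rewrite linearZ /= relabel_pure // !ffunE; congr (_ * _).
rewrite (reindex psi) /=; last by exists phi => x _; rewrite ?phiK ?psiK.
by apply: eq_bigr => x _; rewrite ffunE psiK.
Qed.

Lemma relabel_comp V I J L (phi : J -> I) (psi : L -> J) (A : tensor V I) :
  bijective phi -> bijective psi ->
  relabel V psi (relabel V phi A) = relabel V (phi \o psi) A.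
Proof.
move=> bphi bpsi; rewrite [A]tensor_sum_pure !linear_sum /=.
apply: eq_bigr => k _; rewrite !linearZ /=; congr (_ *: _).
by rewrite !relabel_pure //; apply: bij_comp.
Qed.

(** Products of permutations are read from left to right and relabelling is contravariant, so the
    two reversals cancel. *)
Lemma relabelM V I (sigma tau : {perm I}) (A : tensor V I) :
  relabel V (sigma * tau)%g A = relabel V sigma (relabel V tau A).
Proof.
rewrite relabel_comp; try exact/injF_bij/perm_inj.
by congr (relabel _ _ _); apply: funext => x; rewrite permM.
Qed.

Lemma symmetrizeE V I (G : {set {perm I}}) A :
  symmetrize V G A = #|G|%:R^-1 *: \sum_(sigma in G) relabel V sigma A.
Proof. by rewrite /symmetrize scale_lfunE sum_lfunE. Qed.

Lemma symmetrize_invariants V I (G : {group {perm I}}) A :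
  symmetrize V G A \in invariants V G.
Proof.
apply/invariantsP => sigma sG; rewrite symmetrizeE linearZ /= linear_sum /=.
congr (_ *: _); rewrite [RHS](reindex_inj (mulgI sigma)) /=.
by apply: eq_big => [tau|tau _]; rewrite ?groupMl // relabelM.
Qed.

(** Conjugation by [tau] permutes [G], hence the terms of the average. *)
Lemma relabel_symmetrize V I (G : {set {perm I}}) (tau : {perm I}) A :
  tau \in ('N(G))%g ->
  relabel V tau (symmetrize V G A) = symmetrize V G (relabel V tau A).
Proof.
move=> tN; rewrite !symmetrizeE linearZ /= linear_sum /=; congr (_ *: _).
rewrite [LHS](reindex_inj (conjg_inj tau)) /=.
apply: eq_big => [sigma|sigma _]; first by rewrite memJ_norm.
by rewrite -!relabelM; congr (relabel _ _ _); rewrite conjgE !mulgA mulgV mul1g.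
Qed.

(** Serves to reorder the three symmetrizations that make up [calF]. *)
Lemma symmetrizeC V I (G H : {set {perm I}}) A : H \subset ('N(G))%g ->
  symmetrize V H (symmetrize V G A) = symmetrize V G (symmetrize V H A).
Proof.
move=> sHN; rewrite !(symmetrizeE H) linearZ /=; congr (_ *: _).
rewrite linear_sum.
by apply: eq_bigr => tau tH; rewrite relabel_symmetrize // (subsetP sHN).
Qed.

Lemma symmetrize_tensor_map V W I (G : {set {perm I}}) (g : 'Hom(V, W)) A :
  symmetrize W G (tensor_map I g A) = tensor_map I g (symmetrize V G A).
Proof.
rewrite !symmetrizeE linearZ /=; congr (_ *: _).
rewrite linear_sum /=.
apply: eq_bigr => sigma _.
by rewrite relabel_tensor_map //; apply/injF_bij/perm_inj.
Qed.

End Relabelling.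

(** * The pairing between tensor powers of W and of its dual *)

Section Pairing.
Variables (K : fieldType) (W : vectType K).
Implicit Types I J : finType.

Lemma pairing_is_linear_r I (A : tensor W I) :
  linear (pairing A : tensor (dual W) I -> K^o).
Proof.
move=> a B C; rewrite /pairing scaler_sumr -big_split /=; apply: eq_bigr => j _.
rewrite scaler_sumr -big_split /=; apply: eq_bigr => k _.
by rewrite !ffunE /GRing.scale /= mulrDr mulrDl mulrCA !mulrA.
Qed.
HB.instance Definition _ I (A : tensor W I) :=
  GRing.isLinear.Build K (tensor (dual W) I) K^o _ (pairing A)
    (pairing_is_linear_r A).

Definition pairingr I (B : tensor (dual W) I) (A : tensor W I) : K^o :=
  pairing A B.
Lemma pairingr_is_linear I (B : tensor (dual W) I) : linear (pairingr B).
Proof.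
move=> a A C; rewrite /pairingr /pairing scaler_sumr -big_split /=.
apply: eq_bigr => j _.
rewrite scaler_sumr -big_split /=; apply: eq_bigr => k _.
by rewrite !ffunE /GRing.scale /= !mulrDl !mulrA.
Qed.
HB.instance Definition _ I (B : tensor (dual W) I) :=
  GRing.isLinear.Build K (tensor W I) K^o _ (pairingr B)
    (pairingr_is_linear B).

Lemma pairing_sumr I (J : Type) (r : seq J) (P : pred J) A
    (F : J -> tensor (dual W) I) :
  pairing A (\sum_(j <- r | P j) F j) = \sum_(j <- r | P j) pairing A (F j).
Proof. by rewrite linear_sum. Qed.

Lemma pairing_suml I (J : Type) (r : seq J) (P : pred J) B
    (F : J -> tensor W I) :
  pairing (\sum_(j <- r | P j) F j) B = \sum_(j <- r | P j) pairing (F j) B.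
Proof. by rewrite -/(pairingr _ _) linear_sum. Qed.

Lemma pairingZr I a A (B : tensor (dual W) I) :
  pairing A (a *: B) = a * pairing A B.
Proof. by rewrite linearZ. Qed.

Lemma pairingZl I a (A : tensor W I) B : pairing (a *: A) B = a * pairing A B.
Proof. by rewrite -/(pairingr _ _) linearZ. Qed.

(** Pure tensors span and the pairing is bilinear, so adjointness need only be tested on them. *)
Lemma eq_pairing_pure I J (f : {linear tensor W I -> tensor W J})
    (g : {linear tensor (dual W) J -> tensor (dual W) I}) :
  (forall w l, pairing (f (pure w)) (pure (V := dual W) l) =
               pairing (pure w) (g (pure (V := dual W) l))) ->
  forall A B, pairing (f A) B = pairing A (g B).
Proof.
move=> e A B; rewrite -!/(pairingr _ _) [A]tensor_sum_pure !linear_sum /=.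
apply: eq_bigr => j _; rewrite linearZ /= !linearZ /=.
congr (_ * _); rewrite /pairingr [B]tensor_sum_pure !linear_sum /=.
by apply: eq_bigr => k _; rewrite !linearZ /= e.
Qed.

Lemma pairing_relabel I J (phi : J -> I) (psi : I -> J) :
  cancel phi psi -> cancel psi phi -> forall A B,
  pairing (relabel W phi A) B = pairing A (relabel (dual W) psi B).
Proof.
move=> phiK psiK; apply: eq_pairing_pure => w l /=.
have [bphi bpsi] : bijective phi /\ bijective psi.
  by split; [exists psi | exists phi].
rewrite !relabel_pure // !pairing_pure (reindex psi) /=.
  by apply: eq_bigr => x _; rewrite psiK.
by exists phi => x _; rewrite ?phiK ?psiK.
Qed.

Lemma pairing_relabelV I (sigma : {perm I}) (A : tensor W I) B :
  pairing (relabel W sigma A) B = pairing A (relabel (dual W) (sigma^-1)%g B).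
Proof. by apply: pairing_relabel => x; rewrite ?permK ?permKV. Qed.

(** The basis of W^* dual to the basis [bvec] of W. The basis [bvec] of [dual W], in which tensors
    over [dual W] have their coordinates, is an unrelated choice. *)
Definition dual_vec (i : 'I_(\dim {:W})) : dual W :=
  linfun (coord (vbasis {:W}) i : W -> K^o).

Lemma dual_vecE i (v : W) : (dual_vec i : 'Hom(W, K^o)) v = bcoord i v.
Proof. by rewrite lfunE. Qed.

Lemma pairing_dual_vec I (A : tensor W I) (k : {ffun I -> 'I_(\dim {:W})}) :
  pairing A (pure (fun x => dual_vec (k x))) = A k.
Proof.
rewrite -/(pairingr _ _) {1}[A]tensor_sum_pure linear_sum /=.
rewrite {2}[A]tensor_sum_pure sum_ffunE; apply: eq_bigr => j _.
rewrite linearZ /= /pairingr pairing_pure !ffunE; congr (_ * _).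
by apply: eq_bigr => x _; rewrite dual_vecE.
Qed.

Lemma pairing_nondegenerate_l I (A : tensor W I) :
  (forall l, pairing A (pure (V := dual W) l) = 0) -> A = 0.
Proof. by move=> e; apply/ffunP => k; rewrite -pairing_dual_vec e ffunE. Qed.

Lemma dual_sum (l : dual W) :
  l = \sum_i ((l : 'Hom(W, K^o)) (bvec i) : K) *: dual_vec i.
Proof.
apply/lfunP => v; rewrite {1}[v]sum_bcoord linear_sum sum_lfunE.
apply: eq_bigr => i _; rewrite linearZ /= scale_lfunE dual_vecE.
by rewrite /GRing.scale /= mulrC.
Qed.

(** A change of basis in every factor, from the chosen basis of [dual W] to the dual basis. It makes
    the coordinates of [B] pairings with pure tensors, whence nondegeneracy on the right. *)
Lemma sum_dual_vec I (B : tensor (dual W) I) :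
  B = \sum_(k : {ffun I -> 'I_(\dim {:W})})
        pairing (pure (fun x => bvec (k x))) B *:
        pure (fun x => dual_vec (k x)).
Proof.
rewrite {1}[B]tensor_sum_pure.
under [RHS]eq_bigr => k _.
  rewrite [B in pairing _ B]tensor_sum_pure linear_sum scaler_suml.
  over.
rewrite exchange_big /=; apply: eq_bigr => j _.
under eq_bigr => k _ do rewrite linearZ /= -scalerA.
rewrite -scaler_sumr; congr (_ *: _); apply/ffunP => k.
rewrite sum_ffunE ffunE.
transitivity (\prod_x \sum_i ((bvec (j x) : 'Hom(W, K^o)) (bvec i) : K) *
                bcoord (k x) (dual_vec i)).
  apply: eq_bigr => x _; rewrite {1}[bvec (j x)]dual_sum /bcoord linear_sum.
  by apply: eq_bigr => i _; rewrite linearZ.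
rewrite (prod_sum_ord (fun x i => ((bvec (j x) : 'Hom(W, K^o)) (bvec i) : K) *
                bcoord (k x) (dual_vec i))).
by apply: eq_bigr => i _; rewrite !ffunE pairing_pure big_split.
Qed.

Lemma pairing_nondegenerate_r I (B : tensor (dual W) I) :
  (forall w, pairing (pure w) B = 0) -> B = 0.
Proof.
by move=> e; rewrite [B]sum_dual_vec big1 // => k _; rewrite e scale0r.
Qed.

End Pairing.

(** * Polarization of multilinear forms and detection of invariant tensors *)

Section Polarization.
Variable K : numFieldType.

(** Adding or removing a fixed [x] outside [A] matches the supersets of [A] in pairs of opposite
    signs. *)
Lemma alternating_sum_supersets (I : finType) (A : {set I}) : A != setT ->
  \sum_(S : {set I} | A \subset S) (-1) ^+ #|S| = 0 :> K.
Proof.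
rewrite -subTset => /subsetPn[x _ xA].
rewrite (bigID (fun S : {set I} => x \in S)) /=.
rewrite [X in _ + X](reindex_onto (fun S => S :\ x) (fun S => x |: S)) /=.
  rewrite [X in _ + X](eq_big (fun S : {set I} => (A \subset S) && (x \in S))
                        (fun S => - (-1) ^+ #|S|)) ?sumrN ?subrr // => S.
    rewrite subsetD1 xA andbT !inE eqxx /= andbT; congr (_ && _).
    by apply/eqP/idP => [<-|/setD1K //]; rewrite setU11.
  move=> /andP[_ /eqP SE].
  have xS : x \in S by rewrite -SE setU11.
  by rewrite [in RHS](cardsD1 x) xS exprS mulN1r opprK.
by move=> S /andP[_ xS]; rewrite setU1K.
Qed.

(* Expanding the multilinear form at l_S, where l_S x is the sum of the l y
   over the y in S with the label of x, and summing over S with the sign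
   (-1)^|S|, only the terms indexed by surjective maps survive. *)
Lemma polarization (I : finType) (B : eqType) (b : I -> B) (U : nmodType)
    (Phi : (I -> U) -> K) (l : I -> U) :
  (forall P : I -> pred I, Phi (fun x => \sum_(y | P x y) l y) =
     \sum_(f : {ffun I -> I} | f \in family P) Phi (fun x => l (f x))) ->
  (forall sigma, sigma \in fibre_perms b ->
     Phi (fun x => l (sigma x)) = Phi l) ->
  (forall S : {set I}, Phi (fun x => \sum_(y in S | b y == b x) l y) = 0) ->
  Phi l = 0.
Proof.
move=> multi inv diag.
pose G := fibre_perms b.
have G0 : #|G|%:R != 0 :> K.
  rewrite pnatr_eq0 -lt0n; apply/card_gt0P; exists 1%g.
  by rewrite inE; apply/forallP => x; rewrite perm1.
have : \sum_(S : {set I}) (-1) ^+ #|S| *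
    Phi (fun x => \sum_(y in S | b y == b x) l y) = 0.
  by rewrite big1 // => S _; rewrite diag mulr0.
under eq_bigr => S _.
  rewrite (multi (fun x y => (y \in S) && (b y == b x))) mulr_sumr big_mkcond.
  over.
rewrite exchange_big /=.
(* The contribution of [f] after the exchange of sums: [f] occurs in the expansion for [S] exactly
   when it preserves labels and its image lies in [S]. *)
pose F (f : {ffun I -> I}) : K := if [forall x, b (f x) == b x] then
  Phi (fun x => l (f x)) * \sum_(S : {set I} | f @: setT \subset S) (-1) ^+ #|S|
  else 0.
rewrite (eq_bigr F) => [|f _]; last first.
  rewrite /F -big_mkcond; case: ifP => [/forallP bf|/forallP bf]; last first.
    by rewrite big1 // => S /familyP h; case: bf => x; have /andP[] := h x.
  rewrite mulr_sumr; apply: eq_big => [S|S _]; last by rewrite mulrC.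
  apply/familyP/subsetP => [h _ /imsetP[x _ ->]|h x].
    by have /andP[] := h x.
  by apply/andP; split; [apply/h/imset_f | apply: bf].
(* A self-map of a finite set that is not injective misses a point, so its alternating sum vanishes.
   Each of the remaining label-preserving maps contributes [(-1) ^+ #|I| * Phi l]. *)
rewrite (bigID (fun f : {ffun I -> I} => injectiveb f)) /= [X in _ + X]big1.
  rewrite addr0 => e.
  suff : (-1) ^+ #|I| * #|G|%:R * Phi l = 0.
    by move/eqP; rewrite !mulf_eq0 (negPf G0) orbF signr_eq0 => /eqP.
  (* Injective self-maps are the permutations; the default [1%g] is only taken at maps outside the
     sum. *)
  rewrite -{}e (reindex (@pval I)) /=; last first.
    exists (insubd (1%g : {perm I})) => f; first by rewrite valKd.
    by move=> fi; rewrite insubdK.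
  rewrite (eq_bigl xpredT) => [|sigma]; last by case: sigma.
  rewrite (eq_bigr (fun sigma => if sigma \in G then
      (-1) ^+ #|I| * Phi l else 0)) => [|sigma _].
    by rewrite -big_mkcond sumr_const -mulrA mulr_natl mulrnAr.
  rewrite /F inE pvalE; case: ifP => // sG; rewrite inv ?inE // mulrC.
  congr (_ * _).
  (* Only the full set contains the image of a permutation. *)
  rewrite (eq_bigl (pred1 setT)) ?big_pred1_eq ?cardsT // => S /=.
  rewrite -subTset (_ : [set sigma x | x in setT] = setT) //; apply/setP => x.
  by rewrite inE; apply/imsetP; exists (sigma^-1%g x); rewrite ?permKV.
move=> f finj; rewrite /F alternating_sum_supersets ?mulr0 ?if_same //.
apply: contra finj => /eqP fT; apply/injectiveP.
have /imset_injP fi : #|f @: setT| == #|[set: I]| by rewrite fT.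
by move=> x y; apply: fi; rewrite inE.
Qed.
End Polarization.

Lemma fibre_permsP (I : finType) (B : eqType) (b : I -> B) (sigma : {perm I}) :
  reflect (forall x, b (sigma x) = b x) (sigma \in fibre_perms b).
Proof. by rewrite inE; apply: (iffP forallP) => h x; apply/eqP. Qed.

Lemma fibre_perms_group_set (I : finType) (B : eqType) (b : I -> B) :
  group_set (fibre_perms b).
Proof.
apply/group_setP; split; first by apply/fibre_permsP => x; rewrite perm1.
move=> sigma tau /fibre_permsP bs /fibre_permsP bt; apply/fibre_permsP => x.
by rewrite permM bt.
Qed.
Canonical fibre_perms_group (I : finType) (B : eqType) (b : I -> B) :=
  Group (fibre_perms_group_set b).

(** Multilinearity of [pure], in the form of the first hypothesis of [polarization]. *)
Lemma pure_sum (K : fieldType) (V : vectType K) (I J : finType)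
    (P : I -> pred J) (u : J -> V) :
  pure (fun x => \sum_(y | P x y) u y) =
  \sum_(f : {ffun I -> J} | f \in family P) pure (fun x => u (f x)).
Proof.
apply/ffunP => k; rewrite ffunE sum_ffunE.
under eq_bigr => x _ do rewrite /bcoord linear_sum /=.
rewrite (bigA_distr_big_dep _ (fun x y => bcoord (k x) (u y))).
by apply: eq_bigr => f _; rewrite ffunE.
Qed.

Section TensorPolarization.
Variables (K : numFieldType) (W : vectType K).

(** In the polarization formula the vector placed at a factor depends only on its label, so products
    with one linear form per fibre detect invariant tensors. *)
Lemma tensor_polarization (I : finType) (B : eqType) (b : I -> B)
    (A : tensor W I) : A \in invariants W (fibre_perms b) ->
  (forall m : B -> dual W, pairing A (pure (fun x => m (b x))) = 0) -> A = 0.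
Proof.
move=> /invariantsP Ainv A0; apply: pairing_nondegenerate_l => l.
apply: (polarization (b := b) (Phi := fun l => pairing A (pure l))).
- by move=> P; rewrite pure_sum linear_sum.
- move=> sigma sG.
  have bs : bijective sigma by apply/injF_bij/perm_inj.
  rewrite -(relabel_pure l bs).
  by rewrite -{1}[sigma]invgK -pairing_relabelV Ainv ?groupV.
by move=> S; apply: (A0 (fun c => \sum_(y in S | b y == c) l y)).
Qed.

(** Polarization with a single fibre, on the side of W. It allows equalities in S^m W^* to be
    checked on values. *)
Lemma Sym_poly_at_eq0 m (P : tensor (dual W) 'I_m) :
  P \in Sym (dual W) m -> (forall w, poly_at P w = 0) -> P = 0.
Proof.
move=> /invariantsP Pinv P0; apply: pairing_nondegenerate_r => w.
apply: (polarization (b := fun=> tt) (Phi := fun w => pairing (pure w) P)).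
- by move=> p; rewrite pure_sum -/(pairingr _ _) linear_sum.
- move=> sigma _.
  have bs : bijective sigma by apply/injF_bij/perm_inj.
  rewrite -(relabel_pure w bs).
  by rewrite pairing_relabelV Pinv ?inE.
by move=> S; apply: P0.
Qed.

End TensorPolarization.

(* The product over i : 'I_d of h i, placed in the factors inr (i, _), with
   the l y, placed in the factors inl y. *)
Definition mixed (K : fieldType) (V : vectType K) (L : finType) d m (l : L -> V)
    (h : 'I_d -> tensor V 'I_m) : tensor V (L + 'I_d * 'I_m) :=
  [ffun k : {ffun L + 'I_d * 'I_m -> 'I_(\dim {:V})} =>
     (\prod_y bcoord (k (inl y)) (l y)) *
     \prod_i (h i [ffun p => k (inr (i, p))] : K)].

(** * Products of vectors with d tensors of order m *)

Section Mixed.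
Variables (K : fieldType) (V : vectType K) (L : finType) (d m : nat).
Implicit Types (l : L -> V) (h : 'I_d -> tensor V 'I_m).

Lemma mixed_pure l (w : 'I_d -> 'I_m -> V) :
  mixed l (fun i => pure (w i)) =
  pure (fun x => match x with inl y => l y | inr (i, p) => w i p end).
Proof.
apply/ffunP => k; rewrite !ffunE big_sumType /=; congr (_ * _).
rewrite (eq_bigr (fun x => bcoord (k (inr (x.1, x.2))) (w x.1 x.2)));
  last by case.
rewrite -(pair_bigA _ (fun i p => bcoord (k (inr (i, p))) (w i p))) /=.
by apply: eq_bigr => i _; rewrite ffunE; apply: eq_bigr => p _; rewrite ffunE.
Qed.

Lemma mixed_sum (J : finType) l (P : 'I_d -> pred J) (u : J -> tensor V 'I_m) :
  mixed l (fun i => \sum_(j | P i j) u j) =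
  \sum_(f : {ffun 'I_d -> J} | f \in family P) mixed l (fun i => u (f i)).
Proof.
apply/ffunP => k; rewrite ffunE sum_ffunE.
under [X in _ * X]eq_bigr => i _ do rewrite sum_ffunE.
rewrite (bigA_distr_big_dep _ (fun i j => u j [ffun p => k (inr (i, p))] : K)).
by rewrite mulr_sumr; apply: eq_bigr => f _; rewrite ffunE.
Qed.

Lemma relabel_mixed_rest (sigma : {perm L + 'I_d * 'I_m}) (tau : 'S_d) l h :
  (forall y, sigma (inl y) = inl y) ->
  (forall i p, sigma (inr (i, p)) = inr (tau i, p)) ->
  relabel V sigma (mixed l h) = mixed l (fun i => h (tau i)).
Proof.
move=> sl sr; apply/ffunP => k.
rewrite (relabelE (permK sigma) (permKV sigma)) !ffunE; congr (_ * _).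
  by apply: eq_bigr => y _; rewrite ffunE -{1}[inl y]sl permK.
rewrite (reindex_inj (@perm_inj _ tau)) /=.
apply: eq_bigr => i _; congr (h _ _).
by apply/ffunP => p; rewrite !ffunE -sr permK.
Qed.

(** Such a [sigma] moves the slots of [L] within the fibres of [c], where the vector is constant,
    and the positions within each group, where [h i] is symmetric. *)
Lemma relabel_mixed_block (C : eqType) (c : L -> C)
    (sigma : {perm L + 'I_d * 'I_m}) (l : C -> V) h :
  (forall y, exists2 y', sigma (inl y) = inl y' & c y' = c y) ->
  (forall i p, exists q, sigma (inr (i, p)) = inr (i, q)) ->
  (forall i, h i \in Sym V m) ->
  relabel V sigma (mixed (l \o c) h) = mixed (l \o c) h.
Proof.
move=> sl sr hS.
(* The default values in [f] and in [g] below are never taken, by [sl] and [sr]. *)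
pose f y := if sigma (inl y) is inl z then z else y.
have fE y : sigma (inl y) = inl (f y) by rewrite /f; have [z ->] := sl y.
have cf y : c (f y) = c y by have [z] := sl y; rewrite fE => -[->].
have f_inj : injective f.
  by move=> y z e; have : inl y = inl z :> L + 'I_d * 'I_m;
    [apply: (@perm_inj _ sigma); rewrite !fE e | case].
pose g i p := if sigma (inr (i, p)) is inr (_, q) then q else p.
have gE i p : sigma (inr (i, p)) = inr (i, g i p).
  by rewrite /g; have [q ->] := sr i p.
have g_inj i : injective (g i).
  move=> p q e; have : inr (i, p) = inr (i, q) :> L + 'I_d * 'I_m;
    by [apply: (@perm_inj _ sigma); rewrite !gE e | case].
apply/ffunP => k.
rewrite (relabelE (permK sigma) (permKV sigma)) !ffunE; congr (_ * _).
  rewrite (reindex_inj f_inj); apply: eq_bigr => y _.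
  by rewrite ffunE -fE permK /= cf.
apply: eq_bigr => i _; pose t := perm (g_inj i).
have /invariantsP/(_ t (in_setT _)) {2}<- := hS i.
rewrite (relabelE (permK t) (permKV t)); congr (h _ _); apply/ffunP => p.
rewrite !ffunE; have -> : inr (i, p) = sigma (inr (i, t^-1%g p)).
  by rewrite gE -[g i _](permE (g_inj i)) permKV.
by rewrite permK.
Qed.

End Mixed.

Lemma mixed1_sum (K : fieldType) (V : vectType K) (L : finType) m (l : L -> V)
    (h : tensor V 'I_m) :
  mixed l (fun _ : 'I_1 => h) =
  \sum_k (h k : K) *: mixed l (fun _ : 'I_1 => pure (fun x => bvec (k x))).
Proof.
apply/ffunP => k; rewrite sum_ffunE ffunE big_ord1.
rewrite {1}[h]tensor_sum_pure sum_ffunE mulr_sumr; apply: eq_bigr => j _.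
by rewrite ![in RHS]ffunE big_ord1 ffunE /GRing.scale /= mulrCA.
Qed.

(** Linearity in [h] reduces this to pure [h]. With a single group, it evaluates the product
    polynomial at [w]. *)
Lemma pairing_mixed1 (K : fieldType) (W : vectType K) (L : finType) m
    (l : L -> dual W) (h : tensor (dual W) 'I_m) (w : W) :
  pairing (pure (fun=> w)) (mixed l (fun _ : 'I_1 => h)) =
  (\prod_y (l y : 'Hom(W, K^o)) w) * poly_at h w.
Proof.
rewrite mixed1_sum /poly_at [X in _ = _ * pairing _ X]tensor_sum_pure.
rewrite !pairing_sumr mulr_sumr.
apply: eq_bigr => k _; rewrite !pairingZr [RHS]mulrCA; congr (_ * _).
rewrite mixed_pure !pairing_pure big_sumType /=; congr (_ * _).
rewrite (reindex (fun p => (ord0, p))) //.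
by exists snd => [p|[i p]] //; rewrite (ord1 i).
Qed.

(** * Averaging over a group in characteristic zero *)

Section Averaging.
Variable K : numFieldType.
Implicit Types (V W : vectType K) (I : finType).

Lemma natr_card_group_neq0 I (G : {group {perm I}}) : #|G|%:R != 0 :> K.
Proof. by rewrite pnatr_eq0 -lt0n cardG_gt0. Qed.

Lemma symmetrize_id V I (G : {group {perm I}}) A :
  A \in invariants V G -> symmetrize V G A = A.
Proof.
move=> /invariantsP Ainv; rewrite symmetrizeE (eq_bigr (fun=> A)) //.
by rewrite sumr_const -scaler_nat scalerA mulVf ?scale1r ?natr_card_group_neq0.
Qed.

(** Relabelling by [sigma] is adjoint to relabelling by its inverse, so every term of the average
    pairs equally with an invariant tensor. *)
Lemma pairing_symmetrize W I (G : {group {perm I}}) A B :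
  B \in invariants (dual W) G -> pairing (symmetrize W G A) B = pairing A B.
Proof.
move=> /invariantsP Binv; rewrite symmetrizeE pairingZl pairing_suml.
rewrite (eq_bigr (fun=> pairing A B)) => [|sigma sG].
  by rewrite sumr_const -[X in _ * X]mulr_natl mulKf ?natr_card_group_neq0.
by rewrite pairing_relabelV Binv ?groupV.
Qed.

Lemma pairing_symmetrize_r W I (G : {group {perm I}}) A B :
  A \in invariants W G -> pairing A (symmetrize (dual W) G B) = pairing A B.
Proof.
move=> /invariantsP Ainv; rewrite symmetrizeE pairingZr pairing_sumr.
rewrite (eq_bigr (fun=> pairing A B)) => [|sigma sG].
  by rewrite sumr_const -[X in _ * X]mulr_natl mulKf ?natr_card_group_neq0.
by rewrite -{1}[sigma]invgK -pairing_relabelV Ainv ?groupV.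
Qed.

Lemma pure_const_Sym V m (v : V) : pure (fun=> v) \in Sym V m.
Proof.
apply/invariantsP => sigma _; rewrite relabel_pure //.
exact/injF_bij/perm_inj.
Qed.

Lemma poly_at_symmetrize W m (Q : tensor (dual W) 'I_m) w :
  poly_at (symmetrize (dual W) [set: 'S_m] Q) w = poly_at Q w.
Proof.
exact: (pairing_symmetrize_r (G := [set: 'S_m]%G) _ (pure_const_Sym _ _)).
Qed.

(* Symmetrizing every factor of the d-th power of Q only permutes the slots
   inside each of the d groups, which A does not see. *)
Lemma form_at_symmetrize W d m A (Q : tensor (dual W) 'I_m) :
  A \in invariants W (fibre_perms (fst : 'I_d * 'I_m -> 'I_d)) ->
  form_at A (symmetrize (dual W) [set: 'S_m] Q) = form_at A Q.
Proof.
move=> /invariantsP Ainv; rewrite /form_at.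
(* [mv f] applies [f i] inside group i; expanding the d-th power of the average gives a sum over
   such families. *)
pose mv (f : {ffun 'I_d -> 'S_m}) (x : 'I_d * 'I_m) := (x.1, f x.1 x.2).
have mv_inj f : injective (mv f) by move=> [i p] [j q] [<- /perm_inj ->].
have -> : tensor_pow d (symmetrize (dual W) [set: 'S_m] Q) =
    (#|[set: 'S_m]|%:R^-1) ^+ d *:
    \sum_(f : {ffun 'I_d -> 'S_m})
      relabel (dual W) (perm (mv_inj f)) (tensor_pow d Q).
  apply/ffunP => k; rewrite !ffunE sum_ffunE symmetrizeE.
  transitivity (\prod_(i < d) \sum_(sigma : 'S_m)
      #|[set: 'S_m]|%:R^-1 * (Q [ffun p => k (i, sigma^-1%g p)] : K)).
    apply: eq_bigr => i _; rewrite ffunE sum_ffunE /GRing.scale /= mulr_sumr.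
    apply: eq_big => [sigma|sigma _]; first by rewrite inE.
    rewrite (relabelE (permK sigma) (permKV sigma)); congr (_ * Q _).
    by apply/ffunP => p; rewrite !ffunE.
  rewrite bigA_distr_bigA /= /GRing.scale /= mulr_sumr.
  apply: eq_bigr => f _; rewrite big_split /= prodr_const card_ord.
  congr (_ * _); pose mvV x := (x.1, (f x.1)^-1%g x.2) : 'I_d * 'I_m.
  have e1 : cancel (perm (mv_inj f)) mvV.
    by move=> [i p]; rewrite permE /mvV /= permK.
  have e2 : cancel mvV (perm (mv_inj f)).
    by move=> [i p]; rewrite permE /mv /= permKV.
  rewrite (relabelE e1 e2) ffunE; apply: eq_bigr => i _; congr (Q _).
  by apply/ffunP => p; rewrite !ffunE.
rewrite pairingZr pairing_sumr (eq_bigr (fun=> pairing A (tensor_pow d Q))).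
  rewrite sumr_const card_ffun card_ord cardsT -[X in _ * X]mulr_natl natrX.
  rewrite mulrA -exprMn mulVf ?expr1n ?mul1r //.
  by rewrite -cardsT (natr_card_group_neq0 [set: 'S_m]%G).
move=> f _; rewrite -[perm _]invgK -pairing_relabelV Ainv //.
rewrite groupV; apply/fibre_permsP => x; by rewrite permE.
Qed.

End Averaging.

(** * The permutation groups of the slots and how they normalize one another *)

Section SlotPerms.
Variables (d n : nat) (s : seq nat).
Implicit Types sigma : {perm slot d n s}.

Lemma rest_permsP sigma :
  reflect (exists tau, forall x, sigma x = rest_move tau x)
          (sigma \in rest_perms d n s).
Proof.
rewrite inE; apply: (iffP existsP) => -[tau] => [/forallP h|h]; exists tau.
  by move=> x; apply/eqP.
by apply/forallP => x; apply/eqP.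
Qed.

Lemma equal_permsP sigma :
  reflect (exists pi, forall x, sigma x = equal_move pi x)
          (sigma \in equal_perms d n s).
Proof.
rewrite inE; apply: (iffP existsP) => -[pi] => [/forallP h|h]; exists pi.
  by move=> x; apply/eqP.
by apply/forallP => x; apply/eqP.
Qed.

Lemma rest_perms_group_set : group_set (rest_perms d n s).
Proof.
apply/group_setP; split.
  apply/rest_permsP; exists 1%g => -[y|[i p]] //=; by rewrite !perm1.
move=> sigma1 sigma2 /rest_permsP[tau1 h1] /rest_permsP[tau2 h2].
apply/rest_permsP; exists (tau1 * tau2)%g => -[y|[i p]];
  by rewrite permM h1 h2 //= permM.
Qed.
Canonical rest_perms_group := Group rest_perms_group_set.

Lemma equal_perms_group_set : group_set (equal_perms d n s).
Proof.
apply/group_setP; split.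
  apply/equal_permsP; exists [ffun a => 1%g] => -[[a [c y]]|y] /=;
    by rewrite ?ffunE !perm1.
move=> sigma1 sigma2 /equal_permsP[pi1 h1] /equal_permsP[pi2 h2].
apply/equal_permsP; exists [ffun a => (pi1 a * pi2 a)%g] => -[[a [c y]]|y];
  by rewrite permM h1 h2 //= ffunE permM.
Qed.
Canonical equal_perms_group := Group equal_perms_group_set.

Canonical block_perms_group := [group of block_perms d n s].

(** A permutation carrying fibres into fibres, through [r] on the labels, conjugates
    label-preserving permutations to label-preserving ones. *)
Lemma norm_fibre_perms (I : finType) (B : eqType) (b : I -> B) (r : B -> B)
    (sigma : {perm I}) : (forall x, b (sigma x) = r (b x)) ->
  sigma \in ('N(fibre_perms b))%g.
Proof.
move=> br; rewrite inE; apply/subsetP => _ /imsetP[tau /fibre_permsP bt ->].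
apply/fibre_permsP => x; rewrite conjgE !permM br bt -br.
by rewrite -permM mulVg perm1.
Qed.

Lemma rest_norm_block : rest_perms d n s \subset ('N(block_perms d n s))%g.
Proof.
apply/subsetP => sigma /rest_permsP[tau h].
apply: (norm_fibre_perms
  (r := fun z => match z with inl c => inl c | inr i => inr (tau i) end)) => x.
by rewrite h; case: x => [[a [c [i p]]]|[i p]].
Qed.

Lemma equal_norm_block : equal_perms d n s \subset ('N(block_perms d n s))%g.
Proof.
apply/subsetP => sigma /equal_permsP[pi h].
apply: (norm_fibre_perms (r := fun z => match z with
    inl (existT a c) => inl (existT _ a (pi a c)) | inr i => inr i end)) => x.
by rewrite h; case: x => [[a [c [i p]]]|[i p]].
Qed.

(** The two groups move disjoint sets of slots, so they commute. *)
Lemma rest_norm_equal : rest_perms d n s \subset ('N(equal_perms d n s))%g.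
Proof.
apply: cents_norm; apply/centsP => sigma /rest_permsP[tau h].
move=> sigma' /equal_permsP[pi h']; apply/permP => x.
by rewrite !permM !h !h'; case: x => [[a [c y]]|[i p]].
Qed.

Lemma equal_norm_rest : equal_perms d n s \subset ('N(rest_perms d n s))%g.
Proof.
apply: cents_norm; apply/centsP => sigma /equal_permsP[pi h].
move=> sigma' /rest_permsP[tau h']; apply/permP => x.
by rewrite !permM !h !h'; case: x => [[a [c y]]|[i p]].
Qed.

End SlotPerms.

(** * The regrouping map: its target and its equivariance *)

Section CalF.
Variables (K : fieldType) (W : vectType K) (d n : nat) (s : seq nat).
Variable hn : (0 < n)%N.

Lemma calFE A : calF W d s hn A =
  symmetrize W (equal_perms d n s) (symmetrize W (rest_perms d n s)
    (symmetrize W (block_perms d n s) (relabel W (slot_source (s := s) hn) A))).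
Proof. by rewrite /calF !comp_lfunE. Qed.

(** The normalization relations bring each relabelling next to the symmetrization over its own
    group, which absorbs it. *)
Lemma calF_target A : calF W d s hn A \in target W d n s.
Proof.
rewrite calFE; apply/invariantsP => sigma; rewrite inE => /orP[|sE]; last first.
  exact: (invariantsP _ _ (symmetrize_invariants _ _)).
rewrite inE => /orP[sB|sR]; last first.
  rewrite relabel_symmetrize ?(subsetP (rest_norm_equal _ _ _)) //.
  by rewrite (invariantsP _ _ (symmetrize_invariants _ _)).
rewrite (symmetrizeC _ (rest_norm_block _ _ _)).
rewrite (symmetrizeC _ (equal_norm_block _ _ _)).
exact: (invariantsP _ _ (symmetrize_invariants _ _)).
Qed.

Lemma calF_tensor_map (g : 'End(W)) A :
  bijective (slot_source (s := s) hn : slot d n s -> _) ->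
  calF W d s hn (tensor_map _ g A) = tensor_map _ g (calF W d s hn A).
Proof.
by move=> bsrc; rewrite !calFE relabel_tensor_map // !symmetrize_tensor_map.
Qed.

End CalF.

(** * Indexing the parts of s by value and rank among equal parts *)

Section Parts.
Variable s : seq nat.

Definition part : finType := {a : 'I_(size (undup s)) & 'I_(dmult a)}%type.

Definition part_index (hs : sorted geq s) (y : part) : 'I_(size s) :=
  Ordinal (nth_part hs (ltn_ord (tagged y))).1.

Lemma nth_part_index hs y : nth 0%N s (part_index hs y) = dval (tag y).
Proof. exact: (nth_part hs (ltn_ord (tagged y))).2. Qed.

(** The entry of [s] at the index determines the value, then the offset determines the rank;
    cardinalities agree because the multiplicities add up to the length of [s]. *)
Lemma part_index_bij hs : bijective (part_index hs).
Proof.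
apply: inj_card_bij => [[a c] [a' c'] e|].
  have aa : a = a'.
    apply/val_inj/eqP.
    rewrite -(nth_uniq 0%N (ltn_ord a) (ltn_ord a')) ?undup_uniq //.
    have := nth_part_index hs (existT _ a c).
    by rewrite e nth_part_index /dval /= => ->.
  move: c' e; rewrite -{a'}aa => c' [/addnI/val_inj ->] //.
rewrite card_ord card_tagged sumnE big_map big_enum /=.
under eq_bigr do rewrite card_ord.
rewrite -(perm_size (perm_count_undup s)) size_flatten sumnE !big_map.
rewrite (big_nth 0%N) big_mkord leq_eqVlt; apply/orP; left; apply/eqP.
by apply: eq_bigr => a _; rewrite size_nseq.
Qed.

Definition slot_part d (y : {a : 'I_(size (undup s)) &
    'I_(dmult a) * ('I_d * 'I_(dval a))}) : part :=
  existT _ (tag y) (tagged y).1.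

Lemma big_slot_part (R : comPzSemiRingType) d
    (F : forall c : part, 'I_d -> 'I_(dval (tag c)) -> R) :
  \prod_y F (slot_part y) (tagged y).2.1 (tagged y).2.2 =
  \prod_c \prod_i \prod_p F c i p.
Proof.
(* Slots and parts nest the indices differently; [F1] and [F2] bring both sides to an iterated
   product starting with the values. *)
pose F1 a (z : 'I_(dmult a) * ('I_d * 'I_(dval a))) :=
  F (existT _ a z.1) z.2.1 z.2.2.
pose F2 a c := \prod_i \prod_p F (existT _ a c) i p.
rewrite (eq_bigr (fun y => F1 (tag y) (tagged y))); last by case.
rewrite [RHS](eq_bigr (fun c => F2 (tag c) (tagged c))); last by case.
transitivity (\prod_a \prod_z F1 a z); first by rewrite sig_big_dep.
transitivity (\prod_a \prod_c F2 a c); last by rewrite sig_big_dep.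
apply: eq_bigr => a _ /=.
rewrite -(pair_bigA _ (fun c z => F1 a (c, z))) /=; apply: eq_bigr => c _.
by rewrite -(pair_bigA _ (fun i p => F1 a (c, (i, p)))).
Qed.

End Parts.

(** * The products l_1^{s_1} ... l_q^{s_q} h as tensors *)

Section FsProduct.
Variables (K : fieldType) (W : vectType K) (n : nat) (s : seq nat).
Hypotheses (hn : (0 < n)%N) (hs : sorted geq s) (hsn : (sumn s <= n)%N).
Implicit Types (l : part s -> dual W) (h : tensor (dual W) 'I_(n - sumn s)).

(** The tensor M(l, h), with one h for each of the d groups so that it can be polarized in h. *)
Definition slots_tensor d l (h : 'I_d -> tensor (dual W) 'I_(n - sumn s)) :
    tensor (dual W) (slot d n s) :=
  mixed (l \o @slot_part s d) h.

(** The slots of a single group enumerate the n factors of one polynomial. *)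
Definition position (x : slot 1 n s) : 'I_n := (slot_source hn x).2.

Lemma position_bij : bijective position.
Proof.
have snd_bij : bijective (snd : 'I_1 * 'I_n -> 'I_n).
  by exists (pair ord0) => // -[i p]; rewrite (ord1 i).
exact: (bij_comp snd_bij (slot_source_bij 1 hn hs hsn)).
Qed.

(* The non-symmetrized l_1^{s_1} ... l_q^{s_q} h. *)
Definition Fs_prod l h : tensor (dual W) 'I_n :=
  [ffun k : {ffun 'I_n -> 'I_(\dim {:dual W})} =>
     slots_tensor l (fun _ : 'I_1 => h) [ffun x => k (position x)]].

Lemma poly_at_Fs_prod l h w :
  poly_at (Fs_prod l h) w =
  (\prod_c ((l c : 'Hom(W, K^o)) w : K) ^+ dval (tag c)) * poly_at h w.
Proof.
have [pos' posK posK'] := position_bij.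
have -> : Fs_prod l h =
    relabel (dual W) pos' (slots_tensor l (fun _ : 'I_1 => h)).
  by apply/ffunP => k; rewrite (relabelE posK' posK) ffunE.
rewrite /poly_at -(pairing_relabel posK posK').
rewrite relabel_pure; last by exists pos'.
rewrite pairing_mixed1; congr (_ * _).
rewrite (big_slot_part (fun c (_ : 'I_1) _ => ((l c : 'Hom(W, K^o)) w : K))).
by apply: eq_bigr => c _; rewrite big_ord1 prodr_const card_ord.
Qed.

(** Regrouping the d-th power of the product gives M(l, h): the coordinates of both are products
    over the same slots, taken group by group on one side and part by part on the other. *)
Lemma form_at_Fs_prod d (A : tensor W ('I_d * 'I_n)) l h :
  form_at A (Fs_prod l h) =
  pairing (relabel W (slot_source (s := s) hn) A)
    (slots_tensor l (fun _ : 'I_d => h)).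
Proof.
have [src' srcK srcK'] := slot_source_bij d hn hs hsn.
rewrite (pairing_relabel srcK srcK'); congr (pairing _ _).
apply/ffunP => k; rewrite (relabelE srcK' srcK) !ffunE.
transitivity (\prod_i (\prod_(y : {a : 'I_(size (undup s)) &
     'I_(dmult a) * ('I_1 * 'I_(dval a))})
   bcoord (k (i, position (inl y))) (l (slot_part y)) *
     (h [ffun p => k (i, position (inr (ord0, p)))] : K))).
  apply: eq_bigr => i _; rewrite !ffunE big_ord1; congr (_ * h _).
    by apply: eq_bigr => y _; rewrite !ffunE.
  by apply/ffunP => p; rewrite !ffunE.
rewrite big_split /=; congr (_ * _); last first.
  by apply: eq_bigr => i _; congr (h _); apply/ffunP => p; rewrite !ffunE.
pose F c i p := bcoord (k (slot_source hn (inl (existT _ (tag c)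
  (tagged c, (i, p))) : slot d n s))) (l c).
rewrite [RHS](eq_bigr (fun y => F (slot_part y) (tagged y).2.1 (tagged y).2.2)).
  rewrite big_slot_part [RHS]exchange_big /=; apply: eq_bigr => i _.
  pose F1 c (_ : 'I_1) p := F c i p.
  rewrite (eq_bigr (fun y => F1 (slot_part y) (tagged y).2.1 (tagged y).2.2)).
    by rewrite big_slot_part; apply: eq_bigr => c _; rewrite big_ord1.
  by case=> a [c [j p]] _.
by case=> a [c [j p]] _; rewrite ffunE.
Qed.

End FsProduct.

(** * The kernel of the regrouping map *)

Section Kernel.
Variables (K : numFieldType) (W : vectType K) (d n : nat) (s : seq nat).
Hypotheses (hn : (0 < n)%N) (hs : sorted geq s) (hsn : (sumn s <= n)%N).
Implicit Types (l : part s -> dual W) (h : tensor (dual W) 'I_(n - sumn s)).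

(** Passes from indices into [s] to [part s], and from a product of values to the tensor
    [Fs_prod]. *)
Lemma FsP (P : tensor (dual W) 'I_n) : P \in Sym (dual W) n ->
  Fs s P <-> exists l h, h \in Sym (dual W) (n - sumn s) /\
    forall w, poly_at P w = poly_at (Fs_prod hn l h) w.
Proof.
move=> PS; have [index' indexK indexK'] := part_index_bij hs.
split=> [[_ [l [h [hS Ph]]]]|[l [h [hS Ph]]]].
  exists (l \o part_index hs), h; split=> // w.
  rewrite Ph (poly_at_Fs_prod hn hs hsn); congr (_ * _).
  rewrite (reindex _ (onW_bij _ (part_index_bij hs))) /=.
  by apply: eq_bigr => c _; rewrite (nth_part_index hs).
split=> //; exists (l \o index'), h; split=> // w.
rewrite Ph (poly_at_Fs_prod hn hs hsn); congr (_ * _).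
rewrite [RHS](reindex _ (onW_bij _ (part_index_bij hs))) /=.
by apply: eq_bigr => c _; rewrite (nth_part_index hs) [index' _]indexK.
Qed.

Lemma slots_tensor_block l (h : 'I_d -> tensor (dual W) _) :
  (forall i, h i \in Sym (dual W) (n - sumn s)) ->
  slots_tensor l h \in invariants (dual W) (block_perms d n s).
Proof.
move=> hS; apply/invariantsP => sigma /fibre_permsP bs.
apply: relabel_mixed_block => // [y|i p].
  have := bs (inl y).
  case: (sigma _) => [y'|[i p]]; last by case: y => ? [? []].
  case: y y' => [a [c [i p]]] [a' [c' [i' p']]] /= [e].
  by exists (existT _ a' (c', (i', p'))) => //; apply: e.
have := bs (inr (i, p)); case: (sigma _) => [[a [c [j q]]]|[j q]] //= [->].
by exists q.
Qed.

Lemma slots_tensor_rest l h :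
  slots_tensor l (fun _ => h) \in invariants (dual W) (rest_perms d n s).
Proof.
apply/invariantsP => sigma /rest_permsP[tau st].
by rewrite /slots_tensor (relabel_mixed_rest (tau := tau)) // => *; rewrite st.
Qed.

(** Exchanging equal parts keeps every slot in its group, so on the source side it is a permutation
    inside the groups, under which [A] is invariant. *)
Lemma relabel_slot_source_equal A : A \in SymSym W d n ->
  relabel W (slot_source (s := s) hn) A \in invariants W (equal_perms d n s).
Proof.
move=> /invariantsP Ainv; apply/invariantsP => sigma /equal_permsP[pi sE].
have src_bij := slot_source_bij d hn hs hsn; have [src' srcK srcK'] := src_bij.
pose rho x := slot_source hn (sigma (src' x)).
have rho_inj : injective rho.
  by move=> x y /(can_inj srcK)/perm_inj/(can_inj srcK').
rewrite relabel_comp //; last exact/injF_bij/perm_inj.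
have -> : slot_source (s := s) hn \o sigma = perm rho_inj \o slot_source hn.
  by apply: funext => x /=; rewrite permE /rho srcK.
rewrite -relabel_comp //; last exact/injF_bij/perm_inj.
rewrite Ainv // inE; apply/orP; left; apply/fibre_permsP => x.
rewrite permE /rho /= sE -{2}[x]srcK' /=.
by case: (src' x) => [[a [c [i p]]]|[i p]].
Qed.

(** The exchange of equal parts is moved innermost, where the regrouped [A] absorbs it. M(l, h)
    absorbs the other two symmetrizations: the order of the groups since all the h are equal, the
    blocks since h is symmetric. *)
Lemma pairing_calF A l h : A \in SymSym W d n ->
  h \in Sym (dual W) (n - sumn s) ->
  pairing (calF W d s hn A) (slots_tensor l (fun _ => h)) =
  form_at A (Fs_prod hn l h).
Proof.
move=> AS hS; rewrite (form_at_Fs_prod hn hs hsn) calFE.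
rewrite (symmetrizeC _ (equal_norm_rest _ _ _)).
rewrite (symmetrizeC _ (equal_norm_block _ _ _)).
rewrite (symmetrize_id (relabel_slot_source_equal AS)).
rewrite pairing_symmetrize ?slots_tensor_rest //.
by rewrite pairing_symmetrize ?slots_tensor_block.
Qed.

Lemma calF_eq0 A : A \in SymSym W d n ->
  calF W d s hn A = 0 <-> in_ideal (Fs s) A.
Proof.
move=> AS.
have Afst : A \in invariants W (fibre_perms (fst : 'I_d * 'I_n -> 'I_d)).
  apply/invariantsP => sigma sG; apply: (invariantsP _ _ AS).
  by rewrite inE sG.
split=> [A0 P PFs|A0].
  have PS := PFs.1; have [l [h [hS Ph]]] := (FsP PS).1 PFs.
  (* Both sides are symmetric tensors with the same polynomial function. *)
  have -> : P = symmetrize (dual W) [set: 'S_n] (Fs_prod hn l h).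
    apply/eqP; rewrite -subr_eq0; apply/eqP/Sym_poly_at_eq0.
      by rewrite rpredB // symmetrize_invariants.
    move=> w; rewrite /poly_at linearB /= -!/(poly_at _ w).
    by rewrite poly_at_symmetrize Ph subrr.
  by rewrite form_at_symmetrize // -pairing_calF // A0 -/(pairingr _ _) linear0.
have /invariantsP Tinv := calF_target s hn A.
(* One linear form per block suffices: [l c] for each part, and in each remaining group a power
   [u i] of a linear form. *)
apply: (tensor_polarization (b := @slot_block d n s)) => [|m].
  apply/invariantsP => sigma sB; rewrite Tinv // !in_setU.
  by rewrite (_ : sigma \in block_perms _ _ _).
pose l c := m (inl c); pose u i : tensor (dual W) 'I_(n - sumn s) :=
  pure (fun=> m (inr i)).
have -> : pure (fun x => m (slot_block x)) = slots_tensor l u.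
  rewrite /slots_tensor mixed_pure; congr (pure _); apply: funext.
  by case=> [[a [c [i p]]]|[i p]].
(* The powers [u i] may differ from group to group; polarizing over the groups replaces them by a
   common h, a partial sum of the [u i]. *)
apply: (polarization (b := fun=> tt)
  (Phi := fun u => pairing (calF W d s hn A) (slots_tensor l u))).
- by move=> p; rewrite /slots_tensor mixed_sum pairing_sumr.
- move=> tau _.
  (* A permutation of the [u i] is realized by moving whole groups of remaining slots, which leaves
     F(A) fixed. *)
  have rest_inj : injective (rest_move tau : slot d n s -> _).
    by move=> [y|[i p]] [z|[j q]] //= [] // /perm_inj -> ->.
  rewrite /slots_tensor.
  rewrite -(relabel_mixed_rest (sigma := perm rest_inj) (tau := tau)).
  - rewrite -[perm rest_inj]invgK -pairing_relabelV Tinv //.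
    have restP : perm rest_inj \in rest_perms d n s.
      by apply/rest_permsP; exists tau => x; rewrite permE.
    by rewrite !in_setU !groupV restP orbT.
  - by move=> y; rewrite permE.
  by move=> i p; rewrite permE.
(* With a common h the pairing is the value of [A] at a product, whose symmetrization lies in
   F_s. *)
move=> S; rewrite (pairing_calF _ AS); last first.
  by rewrite rpred_sum // => i _; apply: pure_const_Sym.
rewrite -form_at_symmetrize //; apply: A0.
set h := \sum_(y in S | _) u y.
have QS := symmetrize_invariants [set: 'S_n]%G (Fs_prod hn l h).
apply/(FsP QS); exists l, h; split=> [|w]; last exact: poly_at_symmetrize.
by rewrite rpred_sum // => i _; apply: pure_const_Sym.
Qed.

End Kernel.

(** * The induced map between spaces of invariants, and the theorem *)

Lemma hom_restrict (K : fieldType) (U V : vectType K) (X : {vspace U})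
    (Y : {vspace V}) (f : 'Hom(U, V)) : (forall A, A \in X -> f A \in Y) ->
  exists F : 'Hom(subvs_of X, subvs_of Y), forall A, vsval (F A) = f (vsval A).
Proof.
(* The projection [vsproj Y] changes nothing, since [f] sends X into Y. *)
move=> fXY; exists (linfun (vsproj Y) \o f \o linfun vsval)%VF => A.
by rewrite !comp_lfunE [linfun vsval A]lfunE lfunE /= vsprojK ?fXY ?subvsP.
Qed.

Theorem theorem1p7 (R : realType) (W : vectType R[i])
    (n : nat) (hn : (0 < n)%N)
    (s : seq nat) (hs : sorted geq s) (hsn : (sumn s <= n)%N)
    (d : nat) (hd : (1 < d)%N) :
  exists F : 'Hom(subvs_of (SymSym W d n), subvs_of (target W d n s)),
    [/\ forall A, vsval (F A) = calF W d s hn (vsval A),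
        forall (g : 'End(W)) A, bijective g -> F (inv_act g A) = inv_act g (F A)
      & forall A, A \in lker F <-> in_ideal (Fs s) (vsval A)].
Proof.
have [F FE] := hom_restrict (X := SymSym W d n)
  (fun A _ => calF_target s hn A).
exists F; split=> [A|g A _|A]; first exact: FE.
  apply: val_inj; rewrite /= [LHS]FE /= calF_tensor_map ?FE //.
  exact: slot_source_bij.
rewrite memv_ker -(calF_eq0 hn hs hsn (subvsP A)) -FE.
by split=> [/eqP -> //|FA0]; apply/eqP/val_inj.
Qed.
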